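(* For any DATALOG$^r$ formula $(\Pi,P)\bar t$ the following are equivalent: (i) $(\Pi,P)\bar t$ is equivalent (on all finite structures) to a first-order formula; (ii) $(\Pi,P)\bar t$ is equivalent (on all finite structures) to a bounded DATALOG$^r$ formula.
   Context: All structures are finite. A DATALOG program $\Pi$ over a vocabulary $\tau$ is a finite set of rules $\beta\leftarrow\alpha_1,\dots,\alpha_l$ ($l\ge0$), where each $\alpha_i$ is an atomic formula, a negated atomic formula, or a zero-ary relation symbol, and the head $\beta$ is an atomic formula $R\bar x$ or a zero-ary relation symbol. Relation symbols occurring in some head are intentional; all other symbols (including constants) are extensional, forming $(\tau,\Pi)_{ext}$; intentional symbols occur only positively in the rules. A DATALOG$^r$ program additionally allows in rule bodies formulas $\forall\bar yR\bar y\bar z$ with $R$ intentional. Semantics: for a finite $(\tau,\Pi)_{ext}$-structure $\mathcal A$, intentional relations start as $R_{(0)}=\emptyset$ (zero-ary: FALSE), and $R_{(i+1)}$ is the set of tuples $\bar a$ such that for some rule with head $R\bar x$ and some assignment mapping $\bar x$ to $\bar a$, all body formulas hold in $\mathcal A$ expanded by the stage-$i$ relations; the stages increase to a fixed point $R_{(\infty)}=\bigcup_nR_{(n)}$. A DATALOG$^r$ formula $(\Pi,P)\bar t$ ($P$ an $r$-ary intentional symbol, $\bar t$ new variables) holds of $\bar a$ in $\mathcal A$ iff $\bar a\in P_{(\infty)}$. It is bounded if there is a fixed $k\ge0$ such that $P_{(k)}=P_{(\infty)}$ on all finite structures. *)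

(* Defs.v *)
From HB Require Import structures.
From mathcomp Require Import all_boot.
From Stdlib Require List.

Set Implicit Arguments.
Unset Strict Implicit.
Unset Printing Implicit Defensive.

(** * Vocabularies, finite structures, first-order logic *)

(** Relation symbols (arity 0 allowed) and constants; no function symbols. *)
Record vocab := Vocab {
  rel_sym : Type;
  arity : rel_sym -> nat;
  const_sym : Type
}.

Record structure (sigma : vocab) := Structure {
  dom :> finType;
  dom_nonempty : 0 < #|dom|;
  rel_interp : forall R : rel_sym sigma, pred ((arity R).-tuple dom);
  const_interp : const_sym sigma -> dom
}.

Inductive term (sigma : vocab) (V : Type) :=
  | Var (x : V)
  | Const (c : const_sym sigma).

Inductive atom (sigma : vocab) (V : Type) :=
  | Rel (R : rel_sym sigma) (ts : (arity R).-tuple (term sigma V))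
  | Eq (t1 t2 : term sigma V).

Definition eval_term (sigma : vocab) (V : Type) (A : structure sigma)
    (v : V -> A) (t : term sigma V) : A :=
  match t with
  | Var x => v x
  | Const c => const_interp A c
  end.

Definition eval_atom (sigma : vocab) (V : Type) (A : structure sigma)
    (v : V -> A) (a : atom sigma V) : Prop :=
  match a with
  | Rel R ts => rel_interp (map_tuple (eval_term v) ts)
  | Eq t1 t2 => eval_term v t1 = eval_term v t2
  end.

(** [fo sigma n]: first-order formulas whose free variables are among
    [0, ..., n-1]. Under a quantifier, variable [0] is the newly bound one and
    the previous variables are shifted by one. *)
Inductive fo (sigma : vocab) : nat -> Type :=
  | FAtom n (a : atom sigma 'I_n) : fo sigma n
  | FNot n (f : fo sigma n) : fo sigma n
  | FAnd n (f g : fo sigma n) : fo sigma n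
  | FOr n (f g : fo sigma n) : fo sigma n
  | FEx n (f : fo sigma n.+1) : fo sigma n
  | FAll n (f : fo sigma n.+1) : fo sigma n.

Fixpoint fo_sat (sigma : vocab) (A : structure sigma) (n : nat)
    (f : fo sigma n) : n.-tuple A -> Prop :=
  match f in fo _ n return n.-tuple A -> Prop with
  | FAtom _ a => fun v => eval_atom (tnth v) a
  | FNot _ f => fun v => ~ fo_sat f v
  | FAnd _ f g => fun v => fo_sat f v /\ fo_sat g v
  | FOr _ f g => fun v => fo_sat f v \/ fo_sat g v
  | FEx _ f => fun v => exists b : A, fo_sat f (cons_tuple b v)
  | FAll _ f => fun v => forall b : A, fo_sat f (cons_tuple b v)
  end.

(** * DATALOG^r

    The vocabulary of a program is split into its extensional part [sigma]
    (relation symbols that head no rule, and all constants) and the type [I] of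
    its intentional symbols, with arities [ar]. Thus intentional symbols can
    only occur positively. The variables of a rule are natural numbers. *)

Inductive body_formula (sigma : vocab) (I : Type) (ar : I -> nat) :=
  | BAtom (a : atom sigma nat)
  | BNegAtom (a : atom sigma nat)
  | BInt (R : I) (ts : (ar R).-tuple (term sigma nat))
  (** [BForall e zs] is [forall ys, R ys zs] with [ys] a tuple of [m] distinct
      variables not in [zs]; being bound, the [ys] need no names. *)
  | BForall (R : I) (m k : nat) (e : m + k = ar R) (zs : k.-tuple nat).

(** The rule [R xs <- body]. *)
Inductive rule (sigma : vocab) (I : Type) (ar : I -> nat) :=
  | Rule (R : I) (xs : (ar R).-tuple nat) (body : seq (body_formula sigma ar)).

Arguments BInt {sigma I ar} R ts.
Arguments BForall {sigma I ar} R {m k} e zs.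
Arguments Rule {sigma I ar} R xs body.

(** [int_head]: the symbols of [int_sym] do occur in heads. *)
Record program (sigma : vocab) := Program {
  int_sym : finType;
  int_arity : int_sym -> nat;
  rules : seq (rule sigma int_arity);
  int_head : forall R : int_sym, exists xs body, List.In (Rule R xs body) rules
}.

Section Semantics.
Variables (sigma : vocab) (Pi : program sigma) (A : structure sigma).

Definition int_interp := forall R : int_sym Pi, (int_arity R).-tuple A -> Prop.

Definition body_sat (S : int_interp) (v : nat -> A)
    (b : body_formula sigma (@int_arity sigma Pi)) : Prop :=
  match b with
  | BAtom a => eval_atom v a
  | BNegAtom a => ~ eval_atom v a
  | BInt R ts => S R (map_tuple (eval_term v) ts)
  | BForall R m k e zs =>
      forall ys : m.-tuple A, S R (tcast e (cat_tuple ys (map_tuple v zs)))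
  end.

Fixpoint stage (i : nat) : int_interp :=
  match i with
  | 0 => fun R a => False
  | j.+1 => fun R a =>
      exists (xs : (int_arity R).-tuple nat)
             (body : seq (body_formula sigma (@int_arity sigma Pi)))
             (v : nat -> A),
        [/\ List.In (Rule R xs body) (rules Pi),
            a = map_tuple v xs
          & List.Forall (body_sat (stage j) v) body]
  end.

Definition fixpoint : int_interp := fun R a => exists i, stage i a.

End Semantics.

(** The formula [(Pi, P) ts] with [P] an [r]-ary intentional symbol of [Pi]. *)
Record dlogr_formula (sigma : vocab) (r : nat) := DlogrFormula {
  prog :> program sigma;
  goal : int_sym prog;
  goal_arity : int_arity goal = r
}.

Definition dlogr_sat (sigma : vocab) (r : nat) (F : dlogr_formula sigma r)
    (A : structure sigma) (a : r.-tuple A) : Prop :=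
  fixpoint (tcast (esym (goal_arity F)) a).

Definition bounded (sigma : vocab) (r : nat) (F : dlogr_formula sigma r) : Prop :=
  exists k : nat, forall (A : structure sigma) (a : (int_arity (goal F)).-tuple A),
    stage k a <-> fixpoint a.

(* Main.v *)
Require Import Defs.
From mathcomp Require Import all_boot.
From Stdlib Require List.
From Stdlib Require Import Classical Eqdep_dec.

(** From (ii) to (i): by induction on [j], stage [j] of every intentional symbol
    is first-order definable, since a rule body is a conjunction of definable
    conditions and the variables of a rule are quantified existentially.

    From (i) to (ii): push negations down to the atoms and give every subformula
    with [n] free variables an [n]-ary intentional symbol. A disjunction gets two
    rules, an existential quantifier a rule whose body has one extra variable, and
    a universal quantifier a rule with [forall y R y xs] in its body. The symbol
    of a subformula is complete at a stage that depends only on its depth. *)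

Set Implicit Arguments.
Unset Strict Implicit.
Unset Printing Implicit Defensive.

(** * Preliminaries on tuples and dependent equality *)

Lemma map_tuple_tcast (S T : Type) (f : S -> T) (m n : nat) (e : m = n)
    (t : m.-tuple S) : map_tuple f (tcast e t) = tcast e (map_tuple f t).
Proof. by case: n / e. Qed.

Lemma In_enum (T : finType) (x : T) : List.In x (enum T).
Proof.
have: x \in enum T by rewrite mem_enum.
by elim: (enum T) => //= y s IHs; rewrite inE => /orP[/eqP ->|/IHs]; [left|right].
Qed.

Lemma mktuple_nth (T : Type) (x : T) (n : nat) (a : n.-tuple T) :
  [tuple nth x a i | i < n] = a.
Proof. by apply: eq_from_tnth => i; rewrite tnth_mktuple -tnth_nth. Qed.

Lemma structure_pt (sigma : vocab) (A : structure sigma) : exists x : A, True.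
Proof. by have /card_gt0P[x _] := dom_nonempty A; exists x. Qed.

(** Decidable equality on the index type makes this axiom-free; intentional symbols form a finite
    type, so it applies to rules with equal heads. *)
Lemma existT_inj (T : eqType) (P : T -> Type) (x : T) (y z : P x) :
  existT P x y = existT P x z -> y = z.
Proof. exact/inj_pair2_eq_dec/eq_comparable. Qed.

Lemma Rule_inj (sigma : vocab) (I : finType) (ar : I -> nat) (R : I)
    (xs ys : (ar R).-tuple nat) (b c : seq (body_formula sigma ar)) :
  Rule R xs b = Rule R ys c -> xs = ys /\ b = c.
Proof. by case=> E ->; split=> //; apply: existT_inj E. Qed.

(** * From bounded programs to first-order formulas *)

Section Definability.
Variable sigma : vocab.

Definition vprop := forall A : structure sigma, (nat -> A) -> Prop.

(* A formula under [M] quantifiers is read at [joinv M w v], with [w] the values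
   of the bound variables; only the first [N] values of a valuation matter. *)
Definition fo_def (N : nat) (Q : vprop) : Prop :=
  exists phi : fo sigma N, forall (A : structure sigma) (v : nat -> A),
    Q A v <-> fo_sat phi [tuple v i | i < N].

Definition scons (A : Type) (b : A) (v : nat -> A) (i : nat) : A :=
  if i is j.+1 then v j else b.

Definition joinv (A : Type) (M : nat) (w v : nat -> A) (i : nat) : A :=
  if i < M then w i else v (i - M).

(** * Closure properties of first-order definability *)

Lemma fo_def_iff N (Q Q' : vprop) :
  (forall A v, Q A v <-> Q' A v) -> fo_def N Q -> fo_def N Q'.
Proof. by move=> QQ' [phi H]; exists phi => A v; rewrite -QQ'. Qed.

(** Stands in for functional extensionality: valuations built in different ways may be exchanged
    once they agree below [N]. *)
Lemma fo_def_ext N Q (A : structure sigma) (v w : nat -> A) :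
  fo_def N Q -> (forall i, i < N -> v i = w i) -> Q A v <-> Q A w.
Proof.
case=> phi H vw; rewrite !H.
suff -> : [tuple v i | i < N] = [tuple w i | i < N] by [].
by apply: eq_from_tnth => i; rewrite !tnth_mktuple vw.
Qed.

Lemma fo_def_not N Q : fo_def N Q -> fo_def N (fun A v => ~ Q A v).
Proof. by case=> phi H; exists (FNot phi) => A v /=; rewrite H. Qed.

Lemma fo_def_and N Q Q' :
  fo_def N Q -> fo_def N Q' -> fo_def N (fun A v => Q A v /\ Q' A v).
Proof. by case=> phi H [psi K]; exists (FAnd phi psi) => A v /=; rewrite H K. Qed.

Lemma fo_def_or N Q Q' :
  fo_def N Q -> fo_def N Q' -> fo_def N (fun A v => Q A v \/ Q' A v).
Proof. by case=> phi H [psi K]; exists (FOr phi psi) => A v /=; rewrite H K. Qed.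

(** For [N = 0] there may be no term at all to build an atom from, so a quantifier supplies the
    variable. *)
Lemma fo_def_True N : fo_def N (fun A v => True).
Proof.
by exists (FAll (FAtom (Eq (Var _ ord0) (Var _ ord0)))).
Qed.

Lemma fo_def_False N : fo_def N (fun A v => False).
Proof.
by apply: fo_def_iff (fo_def_not (fo_def_True N)) => A v; split=> // /(_ I).
Qed.

Lemma fo_def_ex N Q :
  fo_def N.+1 Q -> fo_def N (fun A v => exists b, Q A (scons b v)).
Proof.
case=> phi H; exists (FEx phi) => A v /=.
have E b : Q A (scons b v) <-> fo_sat phi (cons_tuple b [tuple v i | i < N]).
  rewrite H; suff -> : [tuple scons b v i | i < N.+1]
                       = cons_tuple b [tuple v i | i < N] by [].
  apply: eq_from_tnth => i; rewrite tnth_mktuple.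
  case: (unliftP ord0 i) => [j|] ->; last by rewrite tnth0.
  by rewrite tnthS tnth_mktuple.
by split=> -[b /E Hb]; exists b.
Qed.

(** A block of [M] quantifiers as one quantifier over valuations: [fo_def_ex] binds variable [0],
    the induction hypothesis the other [M] variables. *)
Lemma fo_def_exv M N Q :
  fo_def (M + N) Q -> fo_def N (fun A v => exists w, Q A (joinv M w v)).
Proof.
elim: M Q => [|M IHM] Q HQ.
  apply: (fo_def_iff _ HQ) => A v.
  have E w : Q A v <-> Q A (joinv 0 w v).
    by apply: (fo_def_ext HQ) => i _; rewrite /joinv subn0.
  by split=> [/(E v)|[w /E]] //; exists v.
have := IHM _ (fo_def_ex HQ); apply: fo_def_iff => A v.
have E b w : Q A (scons b (joinv M w v)) <-> Q A (joinv M.+1 (scons b w) v).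
  by apply: (fo_def_ext HQ) => -[|i].
split=> [[w [b /E Hw]]|[w Hw]]; first by exists (scons b w).
exists (fun i => w i.+1), (w 0); apply/E.
by apply: (iffLR (fo_def_ext HQ _)) Hw => -[|i].
Qed.

Lemma fo_def_allv M N Q :
  fo_def (M + N) Q -> fo_def N (fun A v => forall w, Q A (joinv M w v)).
Proof.
move=> /fo_def_not /fo_def_exv /fo_def_not; apply: fo_def_iff => A v.
split=> [H w|H [w]]; last by apply.
by apply: NNPP => Hw; apply: H; exists w.
Qed.

Lemma fo_def_Forall T (s : seq T) N (Q : T -> vprop) :
  (forall x, List.In x s -> fo_def N (Q x)) ->
  fo_def N (fun A v => List.Forall (fun x => Q x A v) s).
Proof.
elim: s => [|x s IHs] H; first by apply: fo_def_iff (fo_def_True N).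
have Hx := H x (or_introl erefl).
have Hs := IHs (fun y ys => H y (or_intror ys)).
by apply: fo_def_iff (fo_def_and Hx Hs) => A v; rewrite List.Forall_cons_iff.
Qed.

Lemma fo_def_forall (T : finType) N (Q : T -> vprop) :
  (forall x, fo_def N (Q x)) -> fo_def N (fun A v => forall x, Q x A v).
Proof.
move=> H; have := @fo_def_Forall T (enum T) N Q (fun x _ => H x).
apply: fo_def_iff => A v; rewrite List.Forall_forall.
by split=> HQ x; [apply/HQ/In_enum|].
Qed.

(** * Variable bounds and definability of atoms *)

Definition term_bound (t : term sigma nat) : nat :=
  if t is Var x then x.+1 else 0.

Definition shift_term (M : nat) (t : term sigma nat) : term sigma nat :=
  match t with Var x => Var sigma (M + x) | Const c => Const nat c end.

Lemma eval_shift_term M (A : structure sigma) (w v : nat -> A) t :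
  eval_term (joinv M w v) (shift_term M t) = eval_term v t.
Proof.
by case: t => //= x; rewrite /joinv ltnNge leq_addr addKn.
Qed.

Lemma term_bound_shift M N t :
  term_bound t <= N -> term_bound (shift_term M t) <= M + N.
Proof. by case: t => //= x; rewrite -addnS leq_add2l. Qed.

Lemma restrict_term N t : term_bound t <= N ->
  exists t' : term sigma 'I_N, forall (A : structure sigma) (v : nat -> A),
    eval_term (tnth [tuple v i | i < N]) t' = eval_term v t.
Proof.
case: t => [x /= xN|c]; last by exists (Const _ c).
by exists (Var _ (Ordinal xN)) => A v /=; rewrite tnth_mktuple.
Qed.

Definition tuple_bound n (ts : n.-tuple (term sigma nat)) : nat :=
  \max_(i < n) term_bound (tnth ts i).

Definition atom_bound (a : atom sigma nat) : nat :=
  match a with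
  | Rel R ts => tuple_bound ts
  | Eq t u => maxn (term_bound t) (term_bound u)
  end.

Lemma tuple_boundP n (ts : n.-tuple (term sigma nat)) N :
  tuple_bound ts <= N <-> forall i, term_bound (tnth ts i) <= N.
Proof.
by split=> [/bigmax_leqP H i|H]; [apply: H|apply/bigmax_leqP].
Qed.

Lemma fo_def_atom N a : atom_bound a <= N ->
  fo_def N (fun A v => eval_atom v a).
Proof.
case: a => [R ts|t u] /=.
  move/tuple_boundP => H.
  (* Choice over the finitely many argument positions; each chosen term serves all structures at
     once. *)
  have [f Hf] := fin_all_exists (fun i => restrict_term (H i)).
  exists (FAtom (Rel [tuple f i | i < arity R])) => A v /=.
  suff -> : map_tuple (eval_term (tnth [tuple v i | i < N]))
              [tuple f i | i < arity R] = map_tuple (eval_term v) ts by [].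
  by apply: eq_from_tnth => i; rewrite !tnth_map tnth_ord_tuple Hf.
rewrite geq_max => /andP[/restrict_term[t' Ht] /restrict_term[u' Hu]].
by exists (FAtom (Eq t' u')) => A v /=; rewrite Ht Hu.
Qed.

(** * Definability of the stages of a program *)

Variable Pi : program sigma.
Local Notation ar := (@int_arity sigma Pi).

Definition body_bound (b : body_formula sigma ar) : nat :=
  match b with
  | BAtom a | BNegAtom a => atom_bound a
  | BInt R ts => tuple_bound ts
  | BForall R m k e zs => \max_(i < k) (tnth zs i).+1
  end.

(* Quantifying over the argument terms [ts] lets the induction on stages do
   without substitution in formulas. *)
Definition stage_def (j : nat) : Prop :=
  forall N (R : int_sym Pi) (ts : (ar R).-tuple (term sigma nat)),
    tuple_bound ts <= N ->
    fo_def N (fun A v => stage j (map_tuple (eval_term v) ts)).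

Lemma fo_def_body j N b : stage_def j -> body_bound b <= N ->
  fo_def N (fun A v => body_sat (@stage sigma Pi A j) v b).
Proof.
move=> Hj; case: b => [a|a|R ts|R m k e zs] /=.
- exact: fo_def_atom.
- by move=> /fo_def_atom /fo_def_not.
- exact: Hj.
move=> /bigmax_leqP zsN.
(* The universally quantified arguments become variables [0] to [m - 1], and those of [zs] move up
   by [m], which is the layout read by [joinv m w v]. *)
pose us := cat_tuple [tuple Var sigma (nat_of_ord i) | i < m]
             (map_tuple (fun z => Var sigma (m + z)) zs).
have usN : tuple_bound (tcast e us) <= m + N.
  apply/tuple_boundP; case: (ar R) / e => i; rewrite tcast_id.
  case: (split_ordP i) => l ->.
    by rewrite tnth_lshift tnth_mktuple /= ltn_addr.
  by rewrite tnth_rshift tnth_map /= -addnS leq_add2l zsN.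
have := fo_def_allv (Hj _ _ _ usN); apply: fo_def_iff => A v.
have E (w : nat -> A) : map_tuple (eval_term (joinv m w v)) (tcast e us)
    = tcast e (cat_tuple [tuple w i | i < m] (map_tuple v zs)).
  rewrite map_tuple_tcast; congr tcast; apply: eq_from_tnth => i.
  rewrite tnth_map; case: (split_ordP i) => l ->.
    by rewrite !tnth_lshift !tnth_mktuple /= /joinv ltn_ord.
  by rewrite !tnth_rshift !tnth_map /= /joinv ltnNge leq_addr addKn.
split=> [H ys|H w]; last by rewrite E; apply: H.
(* The default [v 0] only makes [ys] a total valuation; positions from [m] on are not read from
   it. *)
by have := H (nth (v 0) ys); rewrite E mktuple_nth.
Qed.

(** The variables of the rule lie below [M] and are quantified as one block; the arguments [ts] are
    shifted past them. Matching the head is a conjunction of equations, which also covers repeated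
    head variables. *)
Lemma fo_def_rule j N (R : int_sym Pi) (ts : (ar R).-tuple (term sigma nat))
    (xs : (ar R).-tuple nat) (body : seq (body_formula sigma ar)) :
  stage_def j -> tuple_bound ts <= N ->
  fo_def N (fun A v => exists w : nat -> A,
    map_tuple (eval_term v) ts = map_tuple w xs /\
    List.Forall (body_sat (@stage sigma Pi A j) w) body).
Proof.
move=> Hj tsN.
pose M := maxn (\max_(i < ar R) (tnth xs i).+1)
               (foldr (fun b m => maxn (body_bound b) m) 0 body).
have xsM i : tnth xs i < M.
  by rewrite leq_max (leq_bigmax (F := fun i => (tnth xs i).+1)).
have bodyM b : List.In b body -> body_bound b <= M.
  move=> bb; rewrite leq_max; apply/orP; right.
  elim: body {M xsM} bb => //= c s IHs [->|/IHs]; rewrite leq_max ?leqnn //.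
  by move=> ->; rewrite orbT.
(* Needed at two sizes: [M + N] for the formula under the quantifiers, and [M] itself to exchange
   [w] for [joinv M w v]. *)
have body_def K : M <= K ->
    fo_def K (fun A v => List.Forall (body_sat (@stage sigma Pi A j) v) body).
  move=> MK; apply: fo_def_Forall => b /bodyM bM.
  by apply: fo_def_body => //; apply: leq_trans bM MK.
have head_def : fo_def (M + N) (fun A v => forall i : 'I_(ar R),
    eval_term v (shift_term M (tnth ts i)) = v (tnth xs i)).
  apply: fo_def_forall => i.
  apply: (@fo_def_atom _ (Eq (shift_term M (tnth ts i)) (Var _ (tnth xs i)))).
  rewrite /= geq_max; apply/andP; split; last exact/ltn_addr/xsM.
  by apply: term_bound_shift; move/tuple_boundP: tsN.
have := fo_def_exv (fo_def_and head_def (body_def _ (leq_addr N M))).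
apply: fo_def_iff => A v; split=> [[w [Hh Hb]]|[w [Hh Hb]]].
  exists (joinv M w v); split=> //; apply: eq_from_tnth => i.
  by rewrite !tnth_map -Hh eval_shift_term.
exists w; split=> [i|].
  rewrite eval_shift_term /joinv xsM.
  by have := congr1 (fun t => tnth t i) Hh; rewrite !tnth_map.
by apply: (iffLR (fo_def_ext (body_def M (leqnn M)) _)) Hb => i iM; rewrite /joinv iM.
Qed.

Lemma fo_def_stage j : stage_def j.
Proof.
elim: j => [|j IHj] N R ts tsN; first exact: fo_def_False.
(* A stage is a disjunction over rules. The list is generalised to [rs] for induction, while the
   bodies are still evaluated at stage [j] of the whole program [Pi]. *)
suff H (rs : seq (rule sigma ar)) : fo_def N (fun A v =>
    exists xs body, List.In (Rule R xs body) rs /\ exists w : nat -> A,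
    map_tuple (eval_term v) ts = map_tuple w xs /\
    List.Forall (body_sat (@stage sigma Pi A j) w) body).
  apply: fo_def_iff (H (rules Pi)) => A v; split.
    by move=> [xs [body [Hin [w [Hh Hb]]]]]; exists xs, body, w.
  by move=> [xs [body [w [Hin Hh Hb]]]]; exists xs, body; split=> //; exists w.
elim: rs => [|ru rs IHrs].
  by apply: fo_def_iff (fo_def_False N) => A v; split=> // -[? [? []]].
have Hru : fo_def N (fun A v =>
    exists xs body, ru = Rule R xs body /\ exists w : nat -> A,
    map_tuple (eval_term v) ts = map_tuple w xs /\
    List.Forall (body_sat (@stage sigma Pi A j) w) body).
  (* If the head of [ru] is not [R], this disjunct is false. *)
  case: (classic (exists xs body, ru = Rule R xs body)); last first.
    move=> nru; apply: fo_def_iff (fo_def_False N) => A v.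
    by split=> // -[xs [body [E _]]]; apply: nru; exists xs, body.
  move=> [xs [body ->]].
  apply: fo_def_iff (@fo_def_rule j N R ts xs body IHj tsN) => A v.
  split=> [H|[xs' [body' [/Rule_inj[<- <-]]]]] //.
  by exists xs, body; split.
apply: fo_def_iff (fo_def_or Hru IHrs) => A v; split.
  by case=> -[xs [body [H1 H2]]]; exists xs, body; split=> //; [left|right].
by move=> [xs [body [[->|H1] H2]]]; [left|right]; exists xs, body.
Qed.

End Definability.

Lemma bounded_fo_definable (sigma : vocab) (r : nat) (F : dlogr_formula sigma r) :
  bounded F -> exists phi : fo sigma r,
    forall (A : structure sigma) (a : r.-tuple A), dlogr_sat F a <-> fo_sat phi a.
Proof.
case: F => Pi P e [k /= Hk]; case: r / e => /=.
have tsN : tuple_bound [tuple Var sigma (nat_of_ord i) | i < int_arity P]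
             <= int_arity P.
  by apply/tuple_boundP => i; rewrite tnth_mktuple /= ltn_ord.
have [phi Hphi] := fo_def_stage k tsN.
(* Nonemptiness of the domain gives a default [x] that extends [a] to a valuation. *)
exists phi => A a; rewrite /dlogr_sat /= -Hk; have [x _] := structure_pt A.
have := Hphi A (nth x a); rewrite mktuple_nth.
suff -> : map_tuple (eval_term (nth x a))
    [tuple Var sigma (nat_of_ord i) | i < int_arity P] = a by [].
by apply: eq_from_tnth => i; rewrite tnth_map tnth_mktuple /= -tnth_nth.
Qed.

(** * From first-order formulas to bounded programs *)

Section Bodies.
Variable sigma : vocab.

(** [body_sat] for relations indexed by an arbitrary type, not only by the
    intentional symbols of a program. *)
Definition gsat (I : Type) (ar : I -> nat) (A : structure sigma)
    (S : forall R : I, (ar R).-tuple A -> Prop) (v : nat -> A)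
    (b : body_formula sigma ar) : Prop :=
  match b with
  | BAtom a => eval_atom v a
  | BNegAtom a => ~ eval_atom v a
  | BInt R ts => S R (map_tuple (eval_term v) ts)
  | BForall R m k e zs =>
      forall ys : m.-tuple A, S R (tcast e (cat_tuple ys (map_tuple v zs)))
  end.

(** Symbols of [I] occur only positively in bodies, also under [BForall]. *)
Lemma gsat_mono (I : Type) (ar : I -> nat) (A : structure sigma)
    (S T : forall R : I, (ar R).-tuple A -> Prop) (v : nat -> A)
    (b : body_formula sigma ar) :
  (forall R a, S R a -> T R a) -> gsat S v b -> gsat T v b.
Proof. by move=> ST; case: b => //= *; apply: ST. Qed.

Variables (I J : Type) (arI : I -> nat) (arJ : J -> nat) (h : J -> I).
Hypothesis hE : forall j, arJ j = arI (h j).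

Definition map_body (b : body_formula sigma arJ) : body_formula sigma arI :=
  match b with
  | BAtom a => BAtom arI a
  | BNegAtom a => BNegAtom arI a
  | BInt R ts => BInt (h R) (tcast (hE R) ts)
  | BForall R m k e zs => BForall (h R) (etrans e (hE R)) zs
  end.

Lemma gsat_map_body (A : structure sigma)
    (S : forall R : I, (arI R).-tuple A -> Prop) (v : nat -> A) b :
  gsat S v (map_body b) <-> gsat (fun j a => S (h j) (tcast (hE j) a)) v b.
Proof.
case: b => //= [R ts|R m k e zs]; first by rewrite map_tuple_tcast.
by split=> H ys; have := H ys; rewrite tcast_trans.
Qed.

Lemma Forall_gsat_map_body (A : structure sigma)
    (S : forall R : I, (arI R).-tuple A -> Prop) (v : nat -> A) s :
  List.Forall (gsat S v) (map map_body s) <->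
  List.Forall (gsat (fun j a => S (h j) (tcast (hE j) a)) v) s.
Proof.
rewrite List.Forall_map !List.Forall_forall.
by split=> H b /H /gsat_map_body.
Qed.

End Bodies.

(** * Disjoint union of finitely many programs with one new symbol *)

Section Extension.
Variables (sigma : vocab) (K : finType) (Pi : K -> program sigma) (n : nat).

(** [None] is the new symbol, of arity [n]; the tag [k] keeps the symbols of different programs
    apart. *)
Definition ext_sym : finType := option {k : K & int_sym (Pi k)}.

Definition ext_arity (R : ext_sym) : nat :=
  if R is Some (existT k R') then int_arity R' else n.

Definition embed (k : K) (R : int_sym (Pi k)) : ext_sym := Some (existT _ k R).

Definition embed_body (k : K) :
    body_formula sigma (@int_arity sigma (Pi k)) -> body_formula sigma ext_arity :=
  map_body (h := @embed k) (fun=> erefl).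

Definition embed_rule (k : K) (ru : rule sigma (@int_arity sigma (Pi k))) :
    rule sigma ext_arity :=
  match ru with
  | Rule R xs body =>
      @Rule sigma ext_sym ext_arity (embed R) xs (map (@embed_body k) body)
  end.

Variable bodies : seq (seq (body_formula sigma ext_arity)).
Hypothesis bodies_nil : bodies <> [::].

Definition vars : n.-tuple nat := [tuple nat_of_ord i | i < n].

Definition ext_rules : seq (rule sigma ext_arity) :=
  map (@Rule sigma ext_sym ext_arity None vars) bodies ++
  List.flat_map (fun k => map (@embed_rule k) (rules (Pi k))) (enum K).

Lemma In_ext_None xs body :
  List.In (@Rule sigma ext_sym ext_arity None xs body) ext_rules <->
  xs = vars /\ List.In body bodies.
Proof.
rewrite List.in_app_iff List.in_map_iff List.in_flat_map; split.
  case=> [[b [/Rule_inj[<- <-]]] //|[k [_ /List.in_map_iff[[R xs' b] []]]]] //.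
by case=> -> Hb; left; exists body.
Qed.

Lemma In_ext_embed k (R : int_sym (Pi k)) xs body :
  List.In (@Rule sigma ext_sym ext_arity (embed R) xs body) ext_rules <->
  exists2 body', body = map (@embed_body k) body' &
    List.In (Rule R xs body') (rules (Pi k)).
Proof.
rewrite List.in_app_iff List.in_map_iff List.in_flat_map; split.
  case=> [[b [] //]|[k' [_ /List.in_map_iff[[R' xs' b] [/= E Hin]]]]].
  (* Equal heads have equal tags; only after identifying these can the symbols be compared, and then
     the tuples and bodies. *)
  have Ek : k' = k by case: E.
  subst k'; have ER : R' = R.
    by case: E => E _; apply: existT_inj E.
  subst R'; case/Rule_inj: E => Exs Eb.
  by exists b => //; rewrite -Exs.
case=> b -> Hin; right; exists k; split; first exact: In_enum.
by apply/List.in_map_iff; exists (Rule R xs b).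
Qed.

(** The new symbol heads a rule because [bodies] is nonempty; embedded symbols inherit their
    rules. *)
Lemma ext_head (R : ext_sym) :
  exists xs body, List.In (@Rule sigma ext_sym ext_arity R xs body) ext_rules.
Proof.
case: R => [[k R]|].
  have [xs [body Hin]] := int_head R.
  by exists xs, (map (@embed_body k) body); apply/In_ext_embed; exists body.
case E: bodies bodies_nil => [//|b s] _; exists vars, b.
by apply/In_ext_None; rewrite E; split=> //; left.
Qed.

Definition ext_program : program sigma := Program ext_head.

(** Rules for embedded symbols mention only symbols of their own program. The agreement is stage by
    stage, so bounds carry over unchanged. *)
Lemma stage_embed (A : structure sigma) j k (R : int_sym (Pi k))
    (a : (int_arity R).-tuple A) :
  @stage sigma ext_program A j (embed R) a <-> stage j a.
Proof.
elim: j k R a => [|j IHj] k R a //=.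
have E (v : nat -> A) b :
    List.Forall (body_sat (@stage sigma ext_program A j) v)
      (map (@embed_body k) b) <->
    List.Forall (body_sat (@stage sigma (Pi k) A j) v) b.
  apply: iff_trans (Forall_gsat_map_body _ _ _ _) _.
  rewrite !List.Forall_forall.
  by split=> H c /H; apply: gsat_mono => R' a'; rewrite tcast_id IHj.
split=> [[xs [body [v [/In_ext_embed[b -> Hin] -> /E Hb]]]]|].
  by exists xs, b, v.
move=> [xs [b [v [Hin -> /E Hb]]]].
exists xs, (map (@embed_body k) b), v; split=> //.
by apply/In_ext_embed; exists b.
Qed.

Lemma stage_ext_None (A : structure sigma) j (a : n.-tuple A) :
  @stage sigma ext_program A j.+1 None a <->
  exists body v, [/\ List.In body bodies, a = map_tuple v vars
    & List.Forall (body_sat (@stage sigma ext_program A j) v) body].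
Proof.
split=> [[xs [body [v [/In_ext_None[-> Hin] Ha Hb]]]]|[body [v [Hin Ha Hb]]]].
  by exists body, v.
by exists vars, body, v; split=> //; apply/In_ext_None.
Qed.

End Extension.

(** * Closure of uniformly bounded definability under the logical operations *)

Section Dlogr.
Variable sigma : vocab.

Definition tprop (n : nat) := forall A : structure sigma, n.-tuple A -> Prop.

(** Uniformly bounded definability: all stages are sound for [Q], and those
    from [k] on are complete. *)
Definition dlogr_def (n : nat) (Q : tprop n) : Prop :=
  exists (F : dlogr_formula sigma n) (k : nat),
    forall (A : structure sigma) (a : n.-tuple A) (j : nat),
      (stage j (tcast (esym (goal_arity F)) a) -> Q A a) /\
      (k <= j -> Q A a -> stage j (tcast (esym (goal_arity F)) a)).

Lemma dlogr_def_iff n (Q Q' : tprop n) :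
  (forall A a, Q A a <-> Q' A a) -> dlogr_def Q -> dlogr_def Q'.
Proof.
move=> E [F [k H]]; exists F, k => A a j; have [H1 H2] := H A a j.
by split=> [/H1 /E|kj /E]; [|apply: H2].
Qed.

(** The common construction behind all connectives: unite programs for the [Q k], replace each [k]
    in the bodies by the goal of its program, and let these bodies define the new symbol. By
    monotonicity, soundness and completeness of the goals pass to it. *)
Lemma dlogr_def_rules (K : finType) (ar : K -> nat) (Q : forall k, tprop (ar k))
    (n : nat) (bodies : seq (seq (body_formula sigma ar))) :
  bodies <> [::] -> (forall k, dlogr_def (Q k)) ->
  dlogr_def (fun A (a : n.-tuple A) => exists body v,
    [/\ List.In body bodies, a = map_tuple v (vars n)
      & List.Forall (gsat (fun k => Q k A) v) body]).
Proof.
(* Finiteness of [K] allows choosing a program and a bound for every [k]. *)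
move=> nil /fin_all_exists[F] /fin_all_exists[m H].
pose h k : ext_sym F := embed (goal (F k)).
have hE k : ar k = ext_arity n (h k) by rewrite -(goal_arity (F k)).
pose bodies' := map (map (map_body hE)) bodies.
have nil' : bodies' <> [::] by rewrite /bodies'; case: (bodies) nil.
have sat (A : structure sigma) j (v : nat -> A) b :
    List.Forall (body_sat (@stage sigma (ext_program nil') A j) v)
      (map (map_body hE) b) <->
    List.Forall (gsat (fun k a =>
      stage j (tcast (esym (goal_arity (F k))) a)) v) b.
  apply: iff_trans (Forall_gsat_map_body hE _ _ _) _.
  rewrite !List.Forall_forall.
  split=> Hb c /Hb; apply: gsat_mono => k a; rewrite stage_embed;
  by rewrite (eq_irrelevance (hE k) (esym (goal_arity (F k)))).
exists (@DlogrFormula sigma n (ext_program nil') None erefl).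
(* From stage [\max_k m k] on all goals are complete; one further stage fires the new rules. *)
exists (\max_k m k).+1 => A a [|j] /=; first by split.
split=> [/stage_ext_None|].
  move=> [body [v [/List.in_map_iff[b [<- Hin]] Ha /sat Hb]]].
  exists b, v; split=> //; apply: List.Forall_impl Hb => c.
  by apply: gsat_mono => k a'; have [] := H k A a' j.
rewrite ltnS => mj [b [v [Hin Ha Hb]]]; apply/stage_ext_None.
exists (map (map_body hE) b), v; split=> //; first exact: List.in_map.
apply/sat; apply: List.Forall_impl Hb => c.
apply: gsat_mono => k a'; have [_] := H k A a' j; apply.
by apply: leq_trans mj; apply: (leq_bigmax (F := m)).
Qed.

Lemma map_vars (A : structure sigma) n (x : A) (a : n.-tuple A) :
  map_tuple (nth x a) (vars n) = a.
Proof.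
by apply: eq_from_tnth => i; rewrite tnth_map tnth_mktuple -tnth_nth.
Qed.

Definition var_terms n : n.-tuple (term sigma nat) :=
  map_tuple (fun i => Var sigma i) (vars n).

Lemma eval_var_terms (A : structure sigma) (v : nat -> A) n :
  map_tuple (eval_term v) (var_terms n) = map_tuple v (vars n).
Proof. by apply: eq_from_tnth => i; rewrite !tnth_map. Qed.

(** Base case for literals: with index type [void] no programs are united, and the new symbol has
    one rule whose body is [b]. *)
Lemma dlogr_def_body n (b : body_formula sigma (fun k : void => 0))
    (Q : tprop n) :
  (forall A v S, Q A (map_tuple v (vars n)) <-> gsat (A := A) S v b) ->
  dlogr_def Q.
Proof.
move=> Hb; have := @dlogr_def_rules void (fun=> 0) (fun k A a => True) n
  [:: [:: b]].
have nil : [:: [:: b]] <> [::] by [].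
move=> /(_ nil) []; first by case.
move=> F HF; apply: dlogr_def_iff (ex_intro _ F HF) => A a; split.
  by move=> [_ [v [[<-|//] -> /List.Forall_cons_iff[/Hb]]]].
have [x _] := structure_pt A => Qa; exists [:: b], (nth x a).
rewrite map_vars; split=> //; first by left.
by constructor=> //; apply/Hb; rewrite map_vars.
Qed.

Definition rename_term n (t : term sigma 'I_n) : term sigma nat :=
  match t with Var x => Var sigma (x : nat) | Const c => Const nat c end.

Definition rename_atom n (a : atom sigma 'I_n) : atom sigma nat :=
  match a with
  | Rel R ts => Rel (map_tuple (@rename_term n) ts)
  | Eq t u => Eq (rename_term t) (rename_term u)
  end.

Lemma eval_rename_term (A : structure sigma) n (v : nat -> A)
    (t : term sigma 'I_n) :
  eval_term v (rename_term t) = eval_term (tnth (map_tuple v (vars n))) t.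
Proof. by case: t => //= x; rewrite tnth_map tnth_mktuple. Qed.

Lemma eval_rename_atom (A : structure sigma) n (v : nat -> A)
    (a : atom sigma 'I_n) :
  eval_atom v (rename_atom a) <-> eval_atom (tnth (map_tuple v (vars n))) a.
Proof.
case: a => [R ts|t u] /=; last by rewrite !eval_rename_term.
set s := map_tuple _ _; set s' := map_tuple _ ts.
suff -> : s = s' by [].
by apply: eq_from_tnth => i; rewrite !tnth_map eval_rename_term.
Qed.

Lemma dlogr_def_atom n (a : atom sigma 'I_n) :
  dlogr_def (fun A v => eval_atom (tnth v) a).
Proof.
apply: (@dlogr_def_body n (BAtom _ (rename_atom a))) => A v S /=.
by rewrite eval_rename_atom.
Qed.

Lemma dlogr_def_neg_atom n (a : atom sigma 'I_n) :
  dlogr_def (fun A v => ~ eval_atom (tnth v) a).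
Proof.
apply: (@dlogr_def_body n (BNegAtom _ (rename_atom a))) => A v S /=.
by rewrite eval_rename_atom.
Qed.

Lemma dlogr_def_and n (Q Q' : tprop n) : dlogr_def Q -> dlogr_def Q' ->
  dlogr_def (fun A a => Q A a /\ Q' A a).
Proof.
move=> HQ HQ'.
pose s : seq (body_formula sigma (fun _ : bool => n)) :=
  [:: BInt true (var_terms n); BInt false (var_terms n)].
have := @dlogr_def_rules bool (fun=> n) (fun b => if b then Q else Q') n [:: s].
have nil : [:: s] <> [::] by [].
move=> /(_ nil) []; first by case.
move=> F HF; apply: dlogr_def_iff (ex_intro _ F HF) => A a; split.
  move=> [_ [v [[<-|//] -> /List.Forall_cons_iff[H1 /List.Forall_cons_iff[H2 _]]]]].
  by move: H1 H2; rewrite /= eval_var_terms.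
have [x _] := structure_pt A => -[Qa Qa']; exists s, (nth x a).
rewrite map_vars; split=> //; first by left.
by do !constructor => //=; rewrite eval_var_terms map_vars.
Qed.

Lemma dlogr_def_or n (Q Q' : tprop n) : dlogr_def Q -> dlogr_def Q' ->
  dlogr_def (fun A a => Q A a \/ Q' A a).
Proof.
move=> HQ HQ'.
pose s b : seq (body_formula sigma (fun _ : bool => n)) :=
  [:: BInt b (var_terms n)].
have := @dlogr_def_rules bool (fun=> n) (fun b => if b then Q else Q') n
  [:: s true; s false].
have nil : [:: s true; s false] <> [::] by [].
move=> /(_ nil) []; first by case.
move=> F HF; apply: dlogr_def_iff (ex_intro _ F HF) => A a; split.
  move=> [_ [v [[<-|[<-|//]] -> /List.Forall_cons_iff[/= + _]]]];
    rewrite eval_var_terms; by [left|right].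
have [x _] := structure_pt A.
case=> Qa; [exists (s true)|exists (s false)]; exists (nth x a);
  rewrite map_vars; split=> //=; try tauto;
  by do !constructor => //=; rewrite eval_var_terms map_vars.
Qed.

Lemma dlogr_def_ex n (Q : tprop n.+1) : dlogr_def Q ->
  dlogr_def (fun A a => exists b, Q A (cons_tuple b a)).
Proof.
move=> HQ.
(* The head uses variables [0] to [n - 1], so [n] is fresh. It comes first because quantifiers of
   [fo] bind variable [0]. *)
pose s : seq (body_formula sigma (fun _ : unit => n.+1)) :=
  [:: BInt tt (cons_tuple (Var sigma n) (var_terms n))].
have := @dlogr_def_rules unit (fun=> n.+1) (fun=> Q) n [:: s].
have nil : [:: s] <> [::] by [].
move=> /(_ nil (fun=> HQ)); apply: dlogr_def_iff => A a.
have E (v : nat -> A) :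
    map_tuple (eval_term v) (cons_tuple (Var sigma n) (var_terms n))
    = cons_tuple (v n) (map_tuple v (vars n)).
  by rewrite -eval_var_terms; apply: val_inj.
split.
  move=> [_ [v [[<-|//] -> /List.Forall_cons_iff[/= + _]]]].
  by rewrite E; exists (v n).
(* This valuation reads [a] below [n] and [b] at the fresh variable [n]. *)
case=> b Qb; exists s, (nth b (rcons a b)).
have Ea : map_tuple (nth b (rcons a b)) (vars n) = a.
  apply: eq_from_tnth => i; rewrite tnth_map tnth_mktuple nth_rcons size_tuple.
  by rewrite ltn_ord -tnth_nth.
rewrite Ea; split=> //; first by left.
by do !constructor => //=; rewrite E Ea nth_rcons size_tuple ltnn eqxx.
Qed.

Lemma dlogr_def_all n (Q : tprop n.+1) : dlogr_def Q ->
  dlogr_def (fun A a => forall b, Q A (cons_tuple b a)).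
Proof.
move=> HQ.
(* One bound position in front of the head variables; [1 + n] computes to [n.+1], hence [erefl]. *)
pose s : seq (body_formula sigma (fun _ : unit => n.+1)) :=
  [:: @BForall sigma unit (fun=> n.+1) tt 1 n erefl (vars n)].
have := @dlogr_def_rules unit (fun=> n.+1) (fun=> Q) n [:: s].
have nil : [:: s] <> [::] by [].
move=> /(_ nil (fun=> HQ)); apply: dlogr_def_iff => A a.
have E (ys : 1.-tuple A) (zs : n.-tuple A) :
    cat_tuple ys zs = cons_tuple (thead ys) zs.
  by apply: val_inj; case: (tupleP ys) => y t; rewrite tuple0.
split.
  move=> [_ [v [[<-|//] -> /List.Forall_cons_iff[/= H _]]]] b.
  by have := H [tuple b]; rewrite E.
have [x _] := structure_pt A => H; exists s, (nth x a).
rewrite map_vars; split=> //; first by left.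
by do !constructor => //=; move=> ys; rewrite E map_vars.
Qed.

(** Intentional symbols cannot be negated in bodies, so a formula and its negation are treated
    together. This replaces a negation normal form: [FNot] swaps the two halves, and the other cases
    use the classical dualities. *)
Lemma fo_dlogr_def n (f : fo sigma n) :
  dlogr_def (fun A a => fo_sat (A := A) f a) /\
  dlogr_def (fun A a => ~ fo_sat (A := A) f a).
Proof.
elim: f => {n} [n a|n f [P N]|n f [Pf Nf] g [Pg Ng]|n f [Pf Nf] g [Pg Ng]
  |n f [P N]|n f [P N]] /=; split.
- exact: dlogr_def_atom.
- exact: dlogr_def_neg_atom.
- exact: N.
- by apply: dlogr_def_iff P => A a; split=> [H|/NNPP] //; apply.
- exact: dlogr_def_and.
- by apply: dlogr_def_iff (dlogr_def_or Nf Ng) => A a; tauto.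
- exact: dlogr_def_or.
- by apply: dlogr_def_iff (dlogr_def_and Nf Ng) => A a; tauto.
- exact: (dlogr_def_ex P).
- apply: dlogr_def_iff (dlogr_def_all N) => A a.
  by split=> [H [b /H]|H b Hb] //; apply: H; exists b.
- exact: (dlogr_def_all P).
- apply: dlogr_def_iff (dlogr_def_ex N) => A a.
  by split=> [[b Hb] /(_ b)|/not_all_ex_not].
Qed.

End Dlogr.

Theorem theorem1 (sigma : vocab) (r : nat) (F : dlogr_formula sigma r) :
  (exists phi : fo sigma r,
     forall (A : structure sigma) (a : r.-tuple A),
       dlogr_sat F a <-> fo_sat phi a)
  <->
  (exists F' : dlogr_formula sigma r,
     bounded F' /\
     forall (A : structure sigma) (a : r.-tuple A),
       dlogr_sat F a <-> dlogr_sat F' a).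
Proof.
split=> [[phi Hphi]|[F' [/bounded_fo_definable[phi Hphi] FF']]]; last first.
  by exists phi => A a; rewrite FF'.
have [[F' [k H]] _] := fo_dlogr_def phi; exists F'; split=> [|A a].
  (* Every stage is sound for [phi] and stage [k] is complete, so each stage [i] is contained in
     stage [k]. *)
  exists k => A a; split=> [|[i]]; first by exists k.
  have [+ _] := H A (tcast (goal_arity F') a) i.
  have [_ +] := H A (tcast (goal_arity F') a) k.
  by rewrite tcastK => /(_ (leqnn k)) H2 H1 /H1.
rewrite Hphi; split=> [Ha|[i Hi]]; last by have [+ _] := H A a i; apply.
by exists k; have [_] := H A a k; apply.
Qed.
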